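(* Let $\hat\sigma_1,\hat\sigma_2,\hat\sigma_3$ be the Pauli matrices, let $\alpha_1,\alpha_2,\alpha_3\in\mathbb{R}$, and let $$\Omega = e^{-i(\alpha_1\hat\sigma_1\otimes\hat\sigma_1+\alpha_2\hat\sigma_2\otimes\hat\sigma_2+\alpha_3\hat\sigma_3\otimes\hat\sigma_3)}.$$ Let $\mathcal{S}=\{n\pi/2 : n\in\{0,1,2,\dots\}\}$ and suppose exactly one of $\alpha_1,\alpha_2,\alpha_3$ lies in $\mathcal{S}$ (a ''two-parameter family''). Let $U=(\mathcal{L}_1\otimes\mathcal{L}_2)\,\Omega\,(\mathcal{R}_1\otimes\mathcal{R}_2)$ for arbitrary single-qubit unitaries $\mathcal{L}_1,\mathcal{L}_2,\mathcal{R}_1,\mathcal{R}_2$. Then for every two-qubit density operator $\rho^{SE}$ on $\mathbb{C}^2_S\otimes\mathbb{C}^2_E$ there exist a single-qubit unitary $V$ acting on $S$ (whose induced rotation $\mathcal{O}_V\in SO(3)$ on the Bloch/correlation indices is a product of Givens rotations) and a single-qubit density operator $\zeta^E$ such that $$\operatorname{Tr}_E\big[U (V\otimes\mathbb{I})\rho^{SE}(V^\dagger\otimes\mathbb{I})U^\dagger\big]=\operatorname{Tr}_E\big[U\big(V\rho^S V^\dagger\otimes\zeta^E\big)U^\dagger\big],$$ where $\rho^S=\operatorname{Tr}_E\rho^{SE}$; i.e. after applying $V$ on the system, the system dynamics are $U$-generated by a product state.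
   Context: For a global two-qubit unitary $U$ and a joint state $\tau^{SE}$ with $\tau^S=\operatorname{Tr}_E\tau^{SE}$, the system dynamics $\tau^S\mapsto\operatorname{Tr}_E(U\tau^{SE}U^\dagger)$ are said to be $U$-generated by a product state if there is a valid single-qubit density operator $\zeta^E$ with $\operatorname{Tr}_E(U\tau^{SE}U^\dagger)=\operatorname{Tr}_E(U(\tau^S\otimes\zeta^E)U^\dagger)$. A local unitary $V$ on the system induces the orthogonal matrix $\mathcal{O}_{ij}=\tfrac12\operatorname{Tr}(\hat\sigma_i V\hat\sigma_j V^\dagger)$, which acts on the system Bloch vector and on the left of the correlation matrix $t_{ij}=\operatorname{Tr}(\rho^{SE}\hat\sigma_i\otimes\hat\sigma_j)$. A Givens rotation is a $3\times3$ rotation by an angle $\theta$ in a coordinate plane $(i,j)$: identity on the remaining coordinate, entries $\cos\theta$ at $(i,i),(j,j)$, and $\mp\sin\theta$ off-diagonal. *)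

(* Defs.v *)
From HB Require Import structures.
From mathcomp Require Import all_boot all_order all_algebra.
From mathcomp Require Import complex mxtens.
From mathcomp Require Import classical_sets boolp filter reals topology normedtype sequences trigo.

Set Implicit Arguments.
Unset Strict Implicit.
Unset Printing Implicit Defensive.

Import Order.TTheory GRing.Theory Num.Theory numFieldNormedType.Exports.
Local Open Scope ring_scope.
Local Open Scope complex_scope.
Local Open Scope classical_set_scope.

Section Defs.
Variable R : realType.
Local Notation C := R[i].

Definition adjmx {m n} (A : 'M[C]_(m, n)) : 'M[C]_(n, m) := (map_mx conjc A)^T.

Definition unitary {n} (U : 'M[C]_n) : Prop :=
  U *m adjmx U = 1%:M /\ adjmx U *m U = 1%:M.

Definition density {n} (rho : 'M[C]_n) : Prop :=
  [/\ adjmx rho = rho,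
      (forall v : 'cV[C]_n, 0 <= (adjmx v *m rho *m v) 0 0)
    & \tr rho = 1].

(* Pauli matrices sigma_1, sigma_2, sigma_3, indexed by k : 'I_3
   (k = 0,1,2 stands for sigma_(k+1)) *)
Definition pauli (k : 'I_3) : 'M[C]_2 :=
  \matrix_(a < 2, b < 2)
    match nat_of_ord k with
    | 0 => if a != b then 1 else 0
    | 1 => if (nat_of_ord a == 0%N) && (nat_of_ord b == 1%N) then - 'i
           else if (nat_of_ord a == 1%N) && (nat_of_ord b == 0%N) then 'i
           else 0
    | _ => if a == b then (if nat_of_ord a == 0%N then 1 else -1) else 0
    end.

(* partial trace over the second (environment) tensor factor;
   indices follow the convention of `tensmx` (mxtens_index (i, k)) *)
Definition ptrE (M : 'M[C]_(2 * 2)) : 'M[C]_2 :=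
  \matrix_(i, j) \sum_(k < 2) M (mxtens_index (i, k)) (mxtens_index (j, k)).

Definition mxpow {n} (A : 'M[C]_n) (k : nat) : 'M[C]_n := iter k (mulmx A) 1%:M.
Definition expsum {n} (A : 'M[C]_n) (N : nat) : 'M[C]_n :=
  \sum_(k < N) ((k`!)%:R^-1 *: mxpow A k).

(* E = exp(A): entrywise convergence of the exponential series
   (convergence in C = convergence of real and imaginary parts) *)
Definition is_expmx {n} (A E : 'M[C]_n) : Prop :=
  forall i j,
    (fun N : nat => complex.Re (expsum A N i j) : R) @ \oo --> (complex.Re (E i j) : R) /\
    (fun N : nat => complex.Im (expsum A N i j) : R) @ \oo --> (complex.Im (E i j) : R).

Definition inS (a : R) : Prop := exists n : nat, a = n%:R * pi / 2.

Definition exactly_one_inS (a1 a2 a3 : R) : Prop :=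
  [\/ inS a1 /\ ~ inS a2 /\ ~ inS a3,
      ~ inS a1 /\ inS a2 /\ ~ inS a3
    | ~ inS a1 /\ ~ inS a2 /\ inS a3].

Definition Hgen (a1 a2 a3 : R) : 'M[C]_(2 * 2) :=
  (a1%:C *: (pauli 0 *t pauli 0)) + (a2%:C *: (pauli 1 *t pauli 1))
  + (a3%:C *: (pauli 2 *t pauli 2)).

Definition rotO (V : 'M[C]_2) : 'M[C]_3 :=
  \matrix_(a, b) (2%:R^-1 * \tr (pauli a *m V *m pauli b *m adjmx V)).

Definition givens (p q : 'I_3) (theta : R) : 'M[R]_3 :=
  \matrix_(a, b)
    if a == b then (if (a == p) || (a == q) then cos theta else 1)
    else if (a == p) && (b == q) then - sin theta
    else if (a == q) && (b == p) then sin theta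
    else 0.

Definition givens_product (O : 'M[C]_3) : Prop :=
  exists gs : seq ('I_3 * 'I_3 * R),
    all (fun g => g.1.1 != g.1.2) gs /\
    O = map_mx (fun x : R => x%:C)
          (\prod_(g <- gs) givens g.1.1 g.1.2 g.2).

End Defs.

(* Main.v *)
(** Conjugating by a Clifford unitary K with K sigma_k K^* = sigma_(k+1) and
    absorbing K into the local unitaries, one may assume sin (2 a3) = 0.
    Let rho be the state after R2 and zeta the diagonal part of its reduced
    environment state, let W = R1 V, and let D be the conjugate by W of
    rho - rho^S (x) zeta.  Then Tr_E (Omega D Omega^* ) vanishes as soon as the
    block B = <0|_E D |1>_E has equal diagonal entries and satisfies one real
    linear relation between Im B_01 and Im B_10.  Every 2x2 matrix is unitarily
    similar to one with equal diagonal entries, and the remaining diagonal phase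
    of W can be used to solve the linear relation.  Finally, by the Euler
    decomposition the rotation induced by any V is a product of three Givens
    rotations. *)

Require Import Defs.
From HB Require Import structures.
From mathcomp Require Import all_boot all_order all_algebra.
From mathcomp Require Import complex mxtens.
From mathcomp Require Import classical_sets boolp filter reals topology normedtype sequences trigo.
From mathcomp Require Import ring lra.
Import Order.TTheory GRing.Theory Num.Theory.
Import numFieldNormedType.Exports.
Local Open Scope ring_scope.
Local Open Scope complex_scope.

Set Implicit Arguments.
Unset Strict Implicit.
Unset Printing Implicit Defensive.

(** * Adjoints, unitaries, density operators and sums over small index types *)

Section Adjoint.
Variable R : realType.
Local Notation C := R[i].

Lemma adjmxE m n (A : 'M[C]_(m, n)) i j : adjmx A i j = (A j i)^*.
Proof. by rewrite !mxE. Qed.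

Lemma adjmxM m n p (A : 'M[C]_(m, n)) (B : 'M[C]_(n, p)) :
  adjmx (A *m B) = adjmx B *m adjmx A.
Proof. by rewrite /adjmx map_mxM trmx_mul. Qed.

Lemma adjmxK m n (A : 'M[C]_(m, n)) : adjmx (adjmx A) = A.
Proof. by apply/matrixP => i j; rewrite !adjmxE conjcK. Qed.

Lemma adjmx1 n : adjmx (1%:M : 'M[C]_n) = 1%:M.
Proof. by rewrite /adjmx map_mx1 trmx1. Qed.

Lemma adjmxB m n (A B : 'M[C]_(m, n)) : adjmx (A - B) = adjmx A - adjmx B.
Proof. by rewrite /adjmx map_mxB linearB. Qed.

Lemma adjmx_tens m n p q (A : 'M[C]_(m, n)) (B : 'M[C]_(p, q)) :
  adjmx (A *t B) = adjmx A *t adjmx B.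
Proof. by rewrite /adjmx map_mxT trmx_tens. Qed.

Lemma tensmx11 m n : (1%:M : 'M[C]_m) *t (1%:M : 'M[C]_n) = 1%:M.
Proof.
apply/matrixP => r s; case: (mxtens_indexP r) => i k; case: (mxtens_indexP s) => j l.
rewrite tensmxE !mxE -natrM mulnb.
by rewrite (can_eq (@mxtens_indexK _ _)) xpair_eqE.
Qed.

Lemma unitary1 n : unitary (1%:M : 'M[C]_n).
Proof. by split; rewrite adjmx1 mulmx1. Qed.

Lemma unitary_adj n (A : 'M[C]_n) : unitary A -> unitary (adjmx A).
Proof. by case=> h1 h2; split; rewrite adjmxK. Qed.

Lemma unitaryM n (A B : 'M[C]_n) : unitary A -> unitary B -> unitary (A *m B).
Proof.
move=> [a1 a2] [b1 b2]; split; rewrite adjmxM.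
  by rewrite mulmxA -(mulmxA A) b1 mulmx1.
by rewrite mulmxA -(mulmxA (adjmx B)) a2 mulmx1.
Qed.

Lemma unitary_tens m n (A : 'M[C]_m) (B : 'M[C]_n) :
  unitary A -> unitary B -> unitary (A *t B).
Proof.
by move=> [a1 a2] [b1 b2]; split; rewrite adjmx_tens tensmx_mul ?a1 ?a2 ?b1 ?b2 tensmx11.
Qed.

Lemma density_conj n (A rho : 'M[C]_n) :
  unitary A -> density rho -> density (A *m rho *m adjmx A).
Proof.
move=> [_ uA] [h1 h2 h3]; split.
- by rewrite !adjmxM adjmxK h1 mulmxA.
- by move=> v; have := h2 (adjmx A *m v); rewrite adjmxM adjmxK !mulmxA.
- by rewrite mxtrace_mulC mulmxA uA mul1mx.
Qed.

Lemma density_diag_ge0 n (rho : 'M[C]_n) i : density rho -> 0 <= rho i i.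
Proof.
case=> _ h _; have := h (delta_mx i 0).
suff -> : adjmx (delta_mx i 0) = delta_mx 0 i :> 'M[C]_(1, n).
  by rewrite -rowE -colE !mxE.
by apply/matrixP => a b; rewrite adjmxE !mxE conjc_nat andbC.
Qed.

Lemma sum_mxtens (V : nmodType) m n (F : 'I_(m * n) -> V) :
  \sum_k F k = \sum_i \sum_j F (mxtens_index (i, j)).
Proof.
rewrite pair_big /= (reindex (@mxtens_index m n)) /=.
  by apply: eq_bigr => -[].
exists (@mxtens_unindex m n) => x _; [exact: mxtens_indexK | exact: mxtens_unindexK].
Qed.

Lemma sum2 (V : nmodType) (F : 'I_2 -> V) : \sum_i F i = F 0 + F 1.
Proof. by rewrite big_ord_recl big_ord1; congr (_ + F _); apply: val_inj. Qed.

Lemma sum3 (V : nmodType) (F : 'I_3 -> V) : \sum_i F i = F 0 + F 1 + F 2.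
Proof.
rewrite !big_ord_recl big_ord0 addr0 addrA.
by congr (_ + F _ + F _); apply: val_inj.
Qed.

Lemma ord2P (P : 'I_2 -> Prop) : P 0 -> P 1 -> forall i, P i.
Proof.
move=> P0 P1 [[|[|//]] lt_i].
  by rewrite (_ : Ordinal _ = 0) //; apply: val_inj.
by rewrite (_ : Ordinal _ = 1) //; apply: val_inj.
Qed.

Lemma ord3P (P : 'I_3 -> Prop) : P 0 -> P 1 -> P 2 -> forall i, P i.
Proof.
move=> P0 P1 P2 [[|[|[|//]]] lt_i].
- by rewrite (_ : Ordinal _ = 0) //; apply: val_inj.
- by rewrite (_ : Ordinal _ = 1) //; apply: val_inj.
- by rewrite (_ : Ordinal _ = 2) //; apply: val_inj.
Qed.

Lemma matrix2P (T : Type) (A B : 'M[T]_2) :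
  A 0 0 = B 0 0 -> A 0 1 = B 0 1 -> A 1 0 = B 1 0 -> A 1 1 = B 1 1 -> A = B.
Proof. by move=> *; apply/matrixP; apply: ord2P; apply: ord2P. Qed.

Lemma mulmx2E (S : pzSemiRingType) m p (A : 'M[S]_(m, 2)) (B : 'M[S]_(2, p)) i j :
  (A *m B) i j = A i 0 * B 0 j + A i 1 * B 1 j.
Proof. by rewrite mxE sum2. Qed.

Lemma mxtrace2 (S : pzSemiRingType) (A : 'M[S]_2) : \tr A = A 0 0 + A 1 1.
Proof. by rewrite /mxtrace sum2. Qed.

End Adjoint.

(** * Environment blocks and the partial trace *)

Section EnvBlocks.
Variable R : realType.
Local Notation C := R[i].

(** This is the system operator [<b|_E M |d>_E]. Seen as a 2x2 array of such blocks, operators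
    multiply blockwise and the partial trace adds the two diagonal blocks. *)
Definition envblk (M : 'M[C]_(2 * 2)) (b d : 'I_2) : 'M[C]_2 :=
  \matrix_(i, j) M (mxtens_index (i, b)) (mxtens_index (j, d)).

Lemma envblkM (M N : 'M[C]_(2 * 2)) b d :
  envblk (M *m N) b d = \sum_k envblk M b k *m envblk N k d.
Proof.
apply/matrixP => i j; rewrite summxE !mxE sum_mxtens exchange_big /=.
by apply: eq_bigr => k _; rewrite !mxE; apply: eq_bigr => l _; rewrite !mxE.
Qed.

Lemma envblkB (M N : 'M[C]_(2 * 2)) b d :
  envblk (M - N) b d = envblk M b d - envblk N b d.
Proof. by apply/matrixP => i j; rewrite !mxE. Qed.

Lemma envblk_tens (A B : 'M[C]_2) b d : envblk (A *t B) b d = B b d *: A.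
Proof. by apply/matrixP => i j; rewrite mxE tensmxE !mxE mulrC. Qed.

Lemma envblk_adj (M : 'M[C]_(2 * 2)) b d :
  envblk (adjmx M) b d = adjmx (envblk M d b).
Proof. by apply/matrixP => i j; rewrite !mxE. Qed.

Lemma envblk_conj_sys (A B : 'M[C]_2) (M : 'M[C]_(2 * 2)) b d :
  envblk ((A *t 1%:M) *m M *m (B *t 1%:M)) b d = A *m envblk M b d *m B.
Proof.
rewrite envblkM (bigD1 d) //= big1 ?addr0 => [|k kd].
  rewrite envblk_tens mxE eqxx scale1r envblkM (bigD1 b) //= big1 ?addr0 => [|k kb].
    by rewrite envblk_tens mxE eqxx scale1r.
  by rewrite envblk_tens mxE eq_sym (negbTE kb) scale0r mul0mx.
by rewrite envblk_tens mxE (negbTE kd) scale0r mulmx0.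
Qed.

Lemma ptrE_envblk (M : 'M[C]_(2 * 2)) : ptrE M = envblk M 0 0 + envblk M 1 1.
Proof. by apply/matrixP => i j; rewrite mxE sum2 !mxE. Qed.

Lemma ptrEB (M N : 'M[C]_(2 * 2)) : ptrE (M - N) = ptrE M - ptrE N.
Proof. by rewrite !ptrE_envblk !envblkB opprD addrACA. Qed.

Lemma ptrE_tens (A B : 'M[C]_2) : ptrE (A *t B) = \tr B *: A.
Proof. by rewrite ptrE_envblk !envblk_tens mxtrace2 scalerDl. Qed.

Lemma ptrE_conj_sys (A B : 'M[C]_2) (M : 'M[C]_(2 * 2)) :
  ptrE ((A *t 1%:M) *m M *m (B *t 1%:M)) = A *m ptrE M *m B.
Proof. by rewrite !ptrE_envblk !envblk_conj_sys mulmxDr mulmxDl. Qed.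

Lemma mul1tensmxE (A : 'M[C]_2) p (M : 'M[C]_(2 * 2, p)) i b s :
  ((1%:M *t A) *m M) (mxtens_index (i, b)) s =
  \sum_k A b k * M (mxtens_index (i, k)) s.
Proof.
rewrite mxE sum_mxtens (bigD1 i) //= [X in _ + X]big1 ?addr0 => [|j ji].
  by apply: eq_bigr => k _; rewrite tensmxE mxE eqxx mul1r.
by apply: big1 => k _; rewrite tensmxE mxE eq_sym (negbTE ji) !mul0r.
Qed.

Lemma mulmx1tensE (A : 'M[C]_2) p (M : 'M[C]_(p, 2 * 2)) r j d :
  (M *m (1%:M *t A)) r (mxtens_index (j, d)) =
  \sum_l M r (mxtens_index (j, l)) * A l d.
Proof.
rewrite mxE sum_mxtens (bigD1 j) //= [X in _ + X]big1 ?addr0 => [|i ij].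
  by apply: eq_bigr => k _; rewrite tensmxE mxE eqxx mul1r.
by apply: big1 => k _; rewrite tensmxE mxE (negbTE ij) mul0r mulr0.
Qed.

(** The partial trace is cyclic with respect to operators acting on the environment alone. *)
Lemma ptrE_conj_env (A B : 'M[C]_2) (M : 'M[C]_(2 * 2)) :
  B *m A = 1%:M -> ptrE ((1%:M *t A) *m M *m (1%:M *t B)) = ptrE M.
Proof.
move=> /matrixP BA; apply/matrixP => i j; rewrite !mxE.
(* This is the form in which the two environment factors have met as [B *m A]. Its off-diagonal
   terms vanish, and expanding both products on the left reaches it by exchanging sums. *)
transitivity (\sum_k \sum_l (B *m A) l k *
    M (mxtens_index (i, k)) (mxtens_index (j, l))); last first.
  apply: eq_bigr => k _; rewrite (bigD1 k) //= BA mxE eqxx mul1r big1 ?addr0 // => l lk.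
  by rewrite BA mxE (negbTE lk) mul0r.
under eq_bigr => b _ do rewrite mulmx1tensE.
rewrite exchange_big [RHS]exchange_big; apply: eq_bigr => l _ /=.
under eq_bigr => b _ do rewrite mul1tensmxE mulr_suml.
rewrite exchange_big; apply: eq_bigr => k _ /=.
by rewrite [in RHS]mxE mulr_suml; apply: eq_bigr => b _; rewrite mulrC mulrA.
Qed.

(** This strips the outer local unitaries: the environment factor disappears by cyclicity and the
    system factor comes out of the trace. *)
Lemma ptrE_conj_unitary (A B : 'M[C]_2) (M : 'M[C]_(2 * 2)) : unitary B ->
  ptrE ((A *t B) *m M *m adjmx (A *t B)) = A *m ptrE M *m adjmx A.
Proof.
move=> [_ uB].
have -> : (A *t B) *m M *m adjmx (A *t B) = (A *t 1%:M) *m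
    ((1%:M *t B) *m M *m (1%:M *t adjmx B)) *m (adjmx A *t 1%:M).
  by rewrite tensmx_decr adjmxM !adjmx_tens !adjmx1 !mulmxA.
by rewrite ptrE_conj_sys ptrE_conj_env.
Qed.

End EnvBlocks.

(** * Exponentials of diagonalised matrices *)

Section Exponential.
Local Open Scope classical_set_scope.
Variable R : realType.
Local Notation C := R[i].

(** This is [exp(i t)], written by its components. *)
Definition cis (t : R) : C := cos t +i* sin t.

Lemma cis0 : cis 0 = 1.
Proof. by rewrite /cis cos0 sin0. Qed.

Lemma cisD s t : cis (s + t) = cis s * cis t.
Proof. by rewrite /cis cosD sinD; simpc; congr (_ +i* _); rewrite addrC. Qed.

Lemma conj_cis t : (cis t)^* = cis (- t).
Proof. by rewrite /cis /= cosN sinN. Qed.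

Lemma cisNK t : cis (- t) * cis t = 1.
Proof. by rewrite -cisD addNr cis0. Qed.

Definition ccvg (u : nat -> C) (l : C) : Prop :=
  ((fun N => complex.Re (u N)) @ \oo --> (complex.Re l : R)) /\
  ((fun N => complex.Im (u N)) @ \oo --> (complex.Im l : R)).

Lemma ReD : {morph (@complex.Re R : C -> R) : x y / x + y}.
Proof. by move=> [? ?] []. Qed.

Lemma ImD : {morph (@complex.Im R : C -> R) : x y / x + y}.
Proof. by move=> [? ?] []. Qed.

Lemma ccvgD u v k l : ccvg u k -> ccvg v l -> ccvg (fun N => u N + v N) (k + l).
Proof.
move=> [u1 u2] [v1 v2]; split.
  by rewrite ReD; under eq_fun do rewrite ReD; exact: cvgD.
by rewrite ImD; under eq_fun do rewrite ImD; exact: cvgD.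
Qed.

Lemma ccvgZ c u l : ccvg u l -> ccvg (fun N => c * u N) (c * l).
Proof.
have ReM (x y : C) : complex.Re (x * y) =
  complex.Re x * complex.Re y - complex.Im x * complex.Im y by case: x y => [? ?] [].
have ImM (x y : C) : complex.Im (x * y) =
  complex.Re x * complex.Im y + complex.Im x * complex.Re y by case: x y => [? ?] [].
move=> [u1 u2]; split.
  by rewrite ReM; under eq_fun do rewrite ReM; apply: cvgB; apply: cvgMr.
by rewrite ImM; under eq_fun do rewrite ImM; apply: cvgD; apply: cvgMr.
Qed.

Lemma ccvg0 : ccvg (fun=> 0) 0.
Proof. by split; exact: cvg_cst. Qed.

Lemma ccvg_sum (I : Type) (r : seq I) (u : I -> nat -> C) (l : I -> C) :
  (forall i, ccvg (u i) (l i)) -> ccvg (fun N => \sum_(i <- r) u i N) (\sum_(i <- r) l i).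
Proof.
move=> ul; elim: r => [|i r IHr].
  by rewrite big_nil; under eq_fun do rewrite big_nil; exact: ccvg0.
by rewrite big_cons; under eq_fun do rewrite big_cons; exact: ccvgD.
Qed.

Lemma ccvg_unique u k l : ccvg u k -> ccvg u l -> k = l.
Proof.
move=> [k1 k2] [l1 l2]; apply/eqP; rewrite eq_complex.
by rewrite (cvg_unique _ k1 l1) // (cvg_unique _ k2 l2) // !eqxx.
Qed.

Lemma is_expmx_unique n (A E F : 'M[C]_n) : is_expmx A E -> is_expmx A F -> E = F.
Proof. by move=> hE hF; apply/matrixP => i j; exact: ccvg_unique (hE i j) (hF i j). Qed.

Lemma mxpowS n (A : 'M[C]_n) k : mxpow A k.+1 = A *m mxpow A k.
Proof. by []. Qed.

Lemma expsum_conj n (A P Q : 'M[C]_n) N : P *m Q = 1%:M -> Q *m P = 1%:M ->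
  expsum (P *m A *m Q) N = P *m expsum A N *m Q.
Proof.
move=> PQ QP; rewrite /expsum mulmx_sumr mulmx_suml; apply: eq_bigr => k _.
rewrite -scalemxAr -scalemxAl; congr (_ *: _).
elim: (nat_of_ord k) => [|m IHm]; first by rewrite [mxpow A 0]/(1%:M) mulmx1.
rewrite !mxpowS IHm.
by rewrite -!mulmxA; congr (_ *m (_ *m _)); rewrite !mulmxA QP mul1mx.
Qed.

(** Every partial sum is conjugated by [P] and [Q], and an entry of the result is a finite linear
    combination of entries of the original partial sum, so limits pass through. *)
Lemma is_expmx_conj n (A E P Q : 'M[C]_n) : P *m Q = 1%:M -> Q *m P = 1%:M ->
  is_expmx A E -> is_expmx (P *m A *m Q) (P *m E *m Q).
Proof.
move=> PQ QP AE i j.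
suff : ccvg (fun N => expsum (P *m A *m Q) N i j) ((P *m E *m Q) i j) by [].
rewrite mxE; under eq_fun do rewrite expsum_conj // mxE.
apply: ccvg_sum => k; rewrite mulrC; under eq_fun do rewrite mulrC.
apply: ccvgZ; rewrite mxE; under eq_fun do rewrite mxE.
by apply: ccvg_sum => l; apply: ccvgZ; exact: AE.
Qed.

Lemma expi_coeff (x : R) k :
  (k`!)%:R^-1 * (0 +i* x) ^+ k = cos_coeff x k +i* sin_coeff x k.
Proof.
(* Powers of [i y] are split by parity. The exponents [m./2] and [m.-1./2] are those in [cos_coeff]
   and [sin_coeff]. *)
have h (y : R) m : (0 +i* y) ^+ m = ((~~ odd m)%:R * (-1) ^+ m./2 * y ^+ m)
    +i* ((odd m)%:R * (-1) ^+ m.-1./2 * y ^+ m).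
  have even p : (0 +i* y) ^+ p.*2 = ((-1) ^+ p * y ^+ p.*2)%:C.
    have rX (z : R) q : z%:C ^+ q = (z ^+ q)%:C.
      by elim: q => [//|q IHq]; rewrite !exprS IHq; simpc.
    have y2 : (0 +i* y) ^+ 2 = (- y ^+ 2)%:C by rewrite !expr2; simpc.
    by rewrite -mul2n !exprM y2 rX [in LHS]exprNn.
  rewrite -(odd_double_half m); case: (odd m); rewrite ?add1n ?add0n.
    rewrite exprS even /= odd_double /= doubleK exprS; simpc; congr (_ +i* _).
    by ring.
  by rewrite even /= odd_double doubleK /=; simpc.
have -> : (k`!)%:R^-1 = ((k`!)%:R^-1 : R)%:C :> C by rewrite fmorphV rmorph_nat.
rewrite h; simpc; rewrite /cos_coeff /sin_coeff /=.
by congr (_ +i* _); rewrite mulrC.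
Qed.

Lemma ccvg_cis (x : R) :
  ccvg (fun N => \sum_(k < N) (k`!)%:R^-1 * (0 +i* x) ^+ k) (cis x).
Proof.
have ReS (F : nat -> C) N :
    complex.Re (\sum_(k < N) F k) = \sum_(0 <= k < N) complex.Re (F k).
  by rewrite big_mkord; rewrite (big_morph _ ReD (erefl : complex.Re (0 : C) = 0)).
have ImS (F : nat -> C) N :
    complex.Im (\sum_(k < N) F k) = \sum_(0 <= k < N) complex.Im (F k).
  by rewrite big_mkord; rewrite (big_morph _ ImD (erefl : complex.Im (0 : C) = 0)).
under eq_fun do under eq_bigr do rewrite expi_coeff.
pose c k := cos_coeff x k +i* sin_coeff x k.
(* Unlocked, cosine and sine are the limits of their series, so convergence of these series is all
   that remains. *)
split; rewrite /= ?cos.unlock ?sin.unlock.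
  rewrite (_ : (fun N => _) = series (cos_coeff x)).
    exact: is_cvg_series_cos_coeff.
  by apply/funext => N; exact: (ReS c N).
rewrite (_ : (fun N => _) = series (sin_coeff x)).
  exact: is_cvg_series_sin_coeff.
by apply/funext => N; exact: (ImS c N).
Qed.

Lemma is_expmx_diag n (x : 'I_n -> R) :
  is_expmx (diag_mx (\row_i (0 +i* x i))) (diag_mx (\row_i cis (x i))).
Proof.
have mxpow_diag k : mxpow (diag_mx (\row_i (0 +i* x i))) k =
    diag_mx (\row_i (0 +i* x i) ^+ k).
  elim: k => [|k IHk]; first by apply/matrixP => i j; rewrite !mxE expr0.
  rewrite mxpowS IHk; apply/matrixP => i j.
  by rewrite mul_diag_mx !mxE exprS mulrnAr.
move=> i j.
suff : ccvg (fun N => expsum (diag_mx (\row_i (0 +i* x i))) N i j)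
   (diag_mx (\row_i cis (x i)) i j) by [].
rewrite !mxE; under eq_fun => N.
  rewrite summxE; under eq_bigr do rewrite mxE mxpow_diag !mxE.
  over.
case: eqP => [_|_]; first exact: ccvg_cis.
rewrite /=; under eq_fun => N do (under eq_bigr do rewrite mulr0n mulr0; rewrite big1_eq).
exact: ccvg0.
Qed.

End Exponential.

(** * Parity blocks of the interaction and the vanishing of a partial trace *)

Section TwoQubitUnitary.
Variable R : realType.
Local Notation C := R[i].

Definition mx2 (a b c d : C) : 'M[C]_2 :=
  \matrix_(i, j) if i == 0 then (if j == 0 then a else b)
                 else (if j == 0 then c else d).

Lemma mx2E a b c d : (mx2 a b c d 0 0 = a) * (mx2 a b c d 0 1 = b) *
  (mx2 a b c d 1 0 = c) * (mx2 a b c d 1 1 = d).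
Proof. by rewrite !mxE. Qed.

Lemma mul_mx2 a b c d a' b' c' d' : mx2 a b c d *m mx2 a' b' c' d' =
  mx2 (a * a' + b * c') (a * b' + b * d') (c * a' + d * c') (c * b' + d * d').
Proof. by apply: matrix2P; rewrite mulmx2E !mx2E. Qed.

Lemma scale_mx2 z a b c d : z *: mx2 a b c d = mx2 (z * a) (z * b) (z * c) (z * d).
Proof. by apply: matrix2P; rewrite mxE !mx2E. Qed.

Lemma add_mx2 a b c d a' b' c' d' : mx2 a b c d + mx2 a' b' c' d' =
  mx2 (a + a') (b + b') (c + c') (d + d').
Proof. by apply: matrix2P; rewrite mxE !mx2E. Qed.

Lemma opp_mx2 a b c d : - mx2 a b c d = mx2 (- a) (- b) (- c) (- d).
Proof. by apply: matrix2P; rewrite mxE !mx2E. Qed.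

Lemma mx2_0 : 0 = mx2 0 0 0 0.
Proof. by apply: matrix2P; rewrite mx2E mxE. Qed.

Lemma mx2_1 : 1%:M = mx2 1 0 0 1.
Proof. by apply: matrix2P; rewrite mx2E mxE. Qed.

Lemma diag_mx2 (z : 'I_2 -> C) : diag_mx (\row_i z i) = mx2 (z 0) 0 0 (z 1).
Proof. by apply: matrix2P; rewrite mx2E !mxE. Qed.

Lemma adj_mx2 a b c d : adjmx (mx2 a b c d) = mx2 a^* c^* b^* d^*.
Proof. by apply: matrix2P; rewrite adjmxE !mx2E. Qed.

Lemma mx2_eta (A : 'M[C]_2) : A = mx2 (A 0 0) (A 0 1) (A 1 0) (A 1 1).
Proof. by apply: matrix2P; rewrite mx2E. Qed.

(* The operator acting as X on span{|00>, |11>} and as Y on span{|01>, |10>}. *)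
Definition paritymx (X Y : 'M[C]_2) : 'M[C]_(2 * 2) :=
  \matrix_(r, s)
    let: (i, k) := mxtens_unindex r in let: (j, l) := mxtens_unindex s in
    if (i == k) == (j == l) then (if i == k then X i j else Y i j) else 0.

Lemma paritymxE X Y i j k l :
  paritymx X Y (mxtens_index (i, k)) (mxtens_index (j, l)) =
  if (i == k) == (j == l) then (if i == k then X i j else Y i j) else 0.
Proof. by rewrite mxE !mxtens_indexK. Qed.

Lemma mxtensP (M N : 'M[C]_(2 * 2)) :
  (forall i k j l, M (mxtens_index (i, k)) (mxtens_index (j, l)) =
                   N (mxtens_index (i, k)) (mxtens_index (j, l))) -> M = N.
Proof.
move=> h; apply/matrixP => r s.
by case: (mxtens_indexP r) => i k; case: (mxtens_indexP s) => j l.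
Qed.

Lemma paritymxM X Y X' Y' :
  paritymx X Y *m paritymx X' Y' = paritymx (X *m X') (Y *m Y').
Proof.
apply: mxtensP => i k j l; rewrite mxE sum_mxtens !sum2 !paritymxE !mulmx2E.
move: i k j l; do 4!apply: ord2P; rewrite /= ?mul0r ?mulr0 ?addr0 ?add0r //.
all: by rewrite addrC.
Qed.

Lemma paritymx1 : paritymx 1%:M 1%:M = 1%:M.
Proof.
apply: mxtensP => i k j l; rewrite paritymxE !mxE (can_eq (@mxtens_indexK _ _)) xpair_eqE.
by move: i k j l; do 4!apply: ord2P.
Qed.

Lemma paritymxZ c X Y : c *: paritymx X Y = paritymx (c *: X) (c *: Y).
Proof.
apply: mxtensP => i k j l; rewrite mxE !paritymxE !mxE.
by case: ifP => _; [case: ifP | rewrite mulr0].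
Qed.

Lemma adj_paritymx X Y : adjmx (paritymx X Y) = paritymx (adjmx X) (adjmx Y).
Proof.
apply: mxtensP => i k j l; rewrite adjmxE !paritymxE !adjmxE eq_sym.
by case: eqP => [->|]; [case: ifP | rewrite conjc0].
Qed.

(** Both blocks are indexed by the system index [i]; in the odd block the environment index is the
    flip of [i], which is what the conditional computes. *)
Lemma diag_paritymx (x : 'I_2 -> 'I_2 -> C) :
  diag_mx (\row_r let: (i, k) := mxtens_unindex r in x i k) =
  paritymx (diag_mx (\row_i x i i)) (diag_mx (\row_i x i (if i == 0 then 1 else 0))).
Proof.
apply: mxtensP => i k j l; rewrite paritymxE !mxE (can_eq (@mxtens_indexK _ _)) xpair_eqE.
by rewrite mxtens_indexK; move: i k j l; do 4!apply: ord2P.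
Qed.

Lemma Hgen_paritymx (a1 a2 a3 : R) : Hgen a1 a2 a3 =
  paritymx (mx2 a3%:C (a1 - a2)%:C (a1 - a2)%:C a3%:C)
           (mx2 (- a3)%:C (a1 + a2)%:C (a1 + a2)%:C (- a3)%:C).
Proof.
apply: mxtensP => i k j l; rewrite paritymxE /Hgen.
rewrite 2!mxE [X in X + _ + _]mxE [X in _ + X + _]mxE [X in _ + X]mxE !tensmxE.
rewrite 8!mxE; move: i k j l; do 4!apply: ord2P.
all: rewrite /= ?mx2E ?(mulr0, mul0r, mulr1, mul1r, addr0, add0r) //.
all: by simpc.
Qed.

Lemma cis_half_sum s t : 2^-1 * (cis (s + t) + cis (s - t)) = cis s * (cos t)%:C :> C.
Proof.
by rewrite !cisD -conj_cis -mulrDr addcJ mulrCA mulKf // pnatr_eq0.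
Qed.

Lemma cis_half_diff s t :
  2^-1 * (cis (s + t) - cis (s - t)) = cis s * (0 +i* sin t) :> C.
Proof.
rewrite !cisD -conj_cis -mulrBr subcJ mulrCA -mulrA mulKf ?pnatr_eq0 //.
by congr (_ * _); simpc.
Qed.

(** On the even block the generator is [a3 + (a1 - a2) sigma_1], on the odd block
    [- a3 + (a1 + a2) sigma_1]. Each exponential is a phase times [cos t - i sin t sigma_1], which
    is [rx t]. *)
Lemma expmx_Hgen (a1 a2 a3 : R) (Omega : 'M[C]_(2 * 2)) :
  is_expmx (- 'i *: Hgen a1 a2 a3) Omega ->
  let rx t := mx2 (cos t)%:C (0 -i* sin t) (0 -i* sin t) (cos t)%:C in
  Omega = paritymx (cis (- a3) *: rx (a1 - a2)) (cis a3 *: rx (a1 + a2)).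
Proof.
move=> hO rx; apply: is_expmx_unique hO _.
(* [h] diagonalises both parity blocks: this is the change to the Bell basis. *)
pose h := mx2 1 1 1 (-1); pose h' := 2^-1 *: h.
have n2 : (2 : C) != 0 by rewrite pnatr_eq0.
have hh : h *m h' = 1%:M.
  by rewrite /h' /h scale_mx2 mul_mx2 mx2_1; congr mx2; field.
have hh' : h' *m h = 1%:M.
  by rewrite /h' /h scale_mx2 mul_mx2 mx2_1; congr mx2; field.
have PQ : paritymx h h *m paritymx h' h' = 1%:M by rewrite paritymxM hh paritymx1.
have QP : paritymx h' h' *m paritymx h h = 1%:M by rewrite paritymxM hh' paritymx1.
(* The eigenvalues of [-i Hgen] are [i] times these numbers: index 0 belongs to the symmetric column
   of [h], where [sigma_1] is 1, and index 1 to the antisymmetric one, where it is -1. *)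
pose x (i k : 'I_2) : R := if i == k then - a3 + (if i == 0 then - (a1 - a2) else a1 - a2)
  else a3 + (if i == 0 then - (a1 + a2) else a1 + a2).
have := is_expmx_conj PQ QP
  (is_expmx_diag (fun r => let: (i, k) := mxtens_unindex r in x i k)).
set d1 := diag_mx _; set d2 := diag_mx _.
have -> : d1 = diag_mx (\row_r let: (i, k) := mxtens_unindex r in 0 +i* x i k).
  by congr diag_mx; apply/rowP => r; rewrite !mxE; case: (mxtens_unindex r).
have -> : d2 = diag_mx (\row_r let: (i, k) := mxtens_unindex r in cis (x i k)).
  by congr diag_mx; apply/rowP => r; rewrite !mxE; case: (mxtens_unindex r).
rewrite (diag_paritymx (fun i k => 0 +i* x i k)) (diag_paritymx (fun i k => cis (x i k))).
rewrite !paritymxM Hgen_paritymx paritymxZ.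
(* The entry [z 1] comes first because it carries the plus sign, so that [cis_half_sum] and
   [cis_half_diff] apply as stated. *)
have conjE (z : 'I_2 -> C) : h *m diag_mx (\row_i z i) *m h' =
    mx2 (2^-1 * (z 1 + z 0)) (- (2^-1 * (z 1 - z 0)))
        (- (2^-1 * (z 1 - z 0))) (2^-1 * (z 1 + z 0)).
  by rewrite /h' /h diag_mx2 scale_mx2 !mul_mx2; congr mx2; ring.
rewrite !conjE /x /= !cis_half_sum !cis_half_diff !scale_mx2.
have oppi (y : R) : - (0 +i* y) = 0 -i* y :> C by simpc.
have miE (y : R) : - 'i * y%:C = 0 -i* y :> C by simpc.
have halfD (y z : R) : 2^-1 * ((0 +i* (y + z)) + (0 +i* (y - z))) = 0 +i* y :> C.
  have -> : (0 +i* (y + z)) + (0 +i* (y - z)) = 2 * (0 +i* y) :> C.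
    by rewrite mulr_natl mulr2n; simpc; congr (0 +i* _); ring.
  by rewrite mulKf.
have halfB (y z : R) : 2^-1 * ((0 +i* (y + z)) - (0 +i* (y - z))) = 0 +i* z :> C.
  have -> : (0 +i* (y + z)) - (0 +i* (y - z)) = 2 * (0 +i* z) :> C.
    by rewrite mulr_natl mulr2n; simpc; congr (0 +i* _); ring.
  by rewrite mulKf.
by rewrite !halfD !halfB !miE -!mulrN !oppi !opprK.
Qed.

(* In the proof the environment blocks of [D] are written
   [x y; z -x], [m n; o m], [m' o'; n' m'] and [-x -y; -z x]. *)
Lemma ptrE_paritymx_eq0 (I w w' p q u v : C) (D : 'M[C]_(2 * 2)) :
  I ^+ 2 = -1 -> w * w' = 1 -> w ^+ 2 = w' ^+ 2 -> p ^+ 2 + q ^+ 2 = 1 -> u ^+ 2 + v ^+ 2 = 1 ->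
  envblk D 0 0 + envblk D 1 1 = 0 -> \tr (envblk D 0 0) = 0 ->
  envblk D 0 1 0 0 = envblk D 0 1 1 1 -> envblk D 1 0 0 0 = envblk D 1 0 1 1 ->
  p * q * (envblk D 0 1 0 1 - envblk D 1 0 1 0) =
    u * v * (envblk D 0 1 1 0 - envblk D 1 0 0 1) ->
  ptrE (paritymx (w *: mx2 p (- I * q) (- I * q) p)
                 (w' *: mx2 u (- I * v) (- I * v) u) *m D *m
        paritymx (w' *: mx2 p (I * q) (I * q) p)
                 (w *: mx2 u (I * v) (I * v) u)) = 0.
Proof.
move=> i2 ww w2 pq uv /eqP; rewrite addrC addr_eq0 => /eqP D11.
rewrite mxtrace2 => /eqP; rewrite addrC addr_eq0 => /eqP x11 m11 m11' h.
(* A parity-preserving operator flips both qubits or neither: diagonal environment blocks are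
   diagonal and the others antidiagonal. *)
have blkE (X Y : 'M[C]_2) : (envblk (paritymx X Y) 0 0 = mx2 (X 0 0) 0 0 (Y 1 1)) *
    (envblk (paritymx X Y) 0 1 = mx2 0 (X 0 1) (Y 1 0) 0) *
    (envblk (paritymx X Y) 1 0 = mx2 0 (Y 0 1) (X 1 0) 0) *
    (envblk (paritymx X Y) 1 1 = mx2 (Y 0 0) 0 0 (X 1 1)).
  by do !split; apply: matrix2P; rewrite mx2E mxE paritymxE.
have mul3E (A B : 'M[C]_(2 * 2)) : ptrE (A *m D *m B) =
    (envblk A 0 0 *m envblk D 0 0 + envblk A 0 1 *m envblk D 1 0) *m envblk B 0 0 +
    (envblk A 0 0 *m envblk D 0 1 + envblk A 0 1 *m envblk D 1 1) *m envblk B 1 0 +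
   ((envblk A 1 0 *m envblk D 0 0 + envblk A 1 1 *m envblk D 1 0) *m envblk B 0 1 +
    (envblk A 1 0 *m envblk D 0 1 + envblk A 1 1 *m envblk D 1 1) *m envblk B 1 1).
  by rewrite ptrE_envblk !(envblkM _ B) !sum2 !envblkM !sum2.
have conjE X Y X' Y' : ptrE (paritymx X Y *m D *m paritymx X' Y') =
    (mx2 (X 0 0) 0 0 (Y 1 1) *m envblk D 0 0 +
     mx2 0 (X 0 1) (Y 1 0) 0 *m envblk D 1 0) *m
     mx2 (X' 0 0) 0 0 (Y' 1 1) +
    (mx2 (X 0 0) 0 0 (Y 1 1) *m envblk D 0 1 +
     mx2 0 (X 0 1) (Y 1 0) 0 *m envblk D 1 1) *m
     mx2 0 (Y' 0 1) (X' 1 0) 0 +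
   ((mx2 0 (Y 0 1) (X 1 0) 0 *m envblk D 0 0 +
     mx2 (Y 0 0) 0 0 (X 1 1) *m envblk D 1 0) *m
     mx2 0 (X' 0 1) (Y' 1 0) 0 +
    (mx2 0 (Y 0 1) (X 1 0) 0 *m envblk D 0 1 +
     mx2 (Y 0 0) 0 0 (X 1 1) *m envblk D 1 1) *m
     mx2 (Y' 0 0) 0 0 (X' 1 1)).
  by rewrite mul3E !blkE.
rewrite conjE D11 {conjE mul3E blkE}.
move: x11 m11 m11' h.
rewrite (mx2_eta (envblk D 0 0)) (mx2_eta (envblk D 0 1)) (mx2_eta (envblk D 1 0)).
move: (envblk D 0 0 0 0) (envblk D 0 0 0 1) (envblk D 0 0 1 0) (envblk D 0 0 1 1) => x y z x1.
move: (envblk D 0 1 0 0) (envblk D 0 1 0 1) (envblk D 0 1 1 0) (envblk D 0 1 1 1) => m n o m1.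
move: (envblk D 1 0 0 0) (envblk D 1 0 0 1) (envblk D 1 0 1 0) (envblk D 1 0 1 1) => m' o' n' m1'.
rewrite !mx2E => -> <- <- h.
rewrite opp_mx2 !scale_mx2 !mx2E !mul_mx2 !add_mx2 !mul_mx2 !add_mx2 mx2_0.
congr mx2.
(* On the diagonal, the part in [x] cancels because both blocks are normalised, and what is left is
   the linear relation [h]. *)
- transitivity (w * w' * x * ((p ^+ 2 - I ^+ 2 * q ^+ 2) - (u ^+ 2 - I ^+ 2 * v ^+ 2))
    + I * (w * w') * (p * q * (n - n') - u * v * (o - o'))); first by ring.
  by rewrite i2 !mulN1r !opprK pq uv h !subrr !mulr0 addr0.
(* Off the diagonal everything carries the factor [w ^+ 2 - w' ^+ 2]; for [w = cis (- a3)] and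
   [w' = cis a3] it vanishes when [sin (2 a3) = 0]. *)
- transitivity ((w ^+ 2 - w' ^+ 2) * (p * u * y + I * p * v * m + I ^+ 2 * q * v * z - I * q * u * m')); first by ring.
  by rewrite w2 subrr mul0r.
- transitivity ((w' ^+ 2 - w ^+ 2) *
    (p * u * z - I * p * v * m' + I ^+ 2 * q * v * y + I * q * u * m)); first by ring.
  by rewrite w2 subrr mul0r.
- transitivity (w * w' * x * ((p ^+ 2 - I ^+ 2 * q ^+ 2) - (u ^+ 2 - I ^+ 2 * v ^+ 2))
    - I * (w * w') * (p * q * (n - n') - u * v * (o - o'))); first by ring.
  by rewrite i2 !mulN1r !opprK pq uv h !subrr !mulr0 subr0.
Qed.

End TwoQubitUnitary.

(** * Single-qubit unitaries, Euler angles and Givens rotations *)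

Section QubitRotations.
Variable R : realType.
Local Notation C := R[i].

(** This solves each angle equation met below: [tan t = - a / b], or a right angle when [b = 0]. *)
Lemma cos_sin_root (a b : R) : exists t, a * cos t + b * sin t = 0.
Proof.
have [->|b0] := eqVneq b 0.
  by exists (pi / 2); rewrite cos_pihalf mulr0 mul0r addr0.
exists (atan (- (a / b))); have c0 : cos (atan (- (a / b))) != 0.
  by rewrite gt_eqF // cos_gt0_pihalf // atan_gtNpi2 atan_ltpi2.
have -> : sin (atan (- (a / b))) = - (a / b) * cos (atan (- (a / b))).
  by rewrite -{2}(atanK (- (a / b))) divfK.
by field.
Qed.

Lemma cos_sin_param (c s : R) : c ^+ 2 + s ^+ 2 = 1 ->
  exists t, c = cos t /\ s = sin t.
Proof.
move=> cs; have c1 : -1 <= c <= 1 by apply/andP; split; nra.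
have sE : sin (acos c) = `|s| by rewrite sin_acos // -cs addrAC subrr add0r sqrtr_sqr.
have cE : cos (acos c) = c by rewrite acosK // in_itv.
have [s0|s0] := leP 0 s.
  by exists (acos c); rewrite cE sE ger0_norm.
by exists (- acos c); rewrite cosN sinN cE sE ltr0_norm // opprK.
Qed.

Lemma cis_param (z : C) : z * conjc z = 1 -> exists t, z = cis t.
Proof.
case: z => x y; simpc => -[]; rewrite -!expr2 => /cos_sin_param[t [-> ->]] _.
by exists t.
Qed.

Definition phase2 (s t : R) : 'M[C]_2 := mx2 (cis s) 0 0 (cis t).

(** This is [exp(- i t sigma_2)]; it turns the Bloch vector by twice the angle [t]. *)
Definition rot2 (t : R) : 'M[C]_2 :=
  mx2 (cos t)%:C (- sin t)%:C (sin t)%:C (cos t)%:C.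

Lemma adj_phase2 s t : adjmx (phase2 s t) = phase2 (- s) (- t).
Proof. by rewrite /phase2 adj_mx2 !conj_cis conjc0. Qed.

Lemma adj_rot2 t : adjmx (rot2 t) = rot2 (- t).
Proof. by rewrite /rot2 adj_mx2 !conjc_real cosN sinN opprK. Qed.

Lemma phase2NK s t : phase2 (- s) (- t) *m phase2 s t = 1%:M.
Proof. by rewrite mul_mx2 !cisNK mx2_1 !(mul0r, mulr0) !(add0r, addr0). Qed.

Lemma rot2NK t : rot2 (- t) *m rot2 t = 1%:M.
Proof.
rewrite mul_mx2 mx2_1 cosN sinN; have := cos2Dsin2 t.
rewrite !expr2 => h; congr mx2; rewrite -!rmorphM -rmorphD ?opprK /=.
- by rewrite h.
- by congr (_ +i* _); ring.
- by congr (_ +i* _); ring.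
- by rewrite addrC mulNr mulrN opprK h.
Qed.

Lemma unitary_phase2 s t : unitary (phase2 s t).
Proof.
split; rewrite adj_phase2 ?phase2NK //.
by rewrite -{1}(opprK s) -{1}(opprK t) phase2NK.
Qed.

Lemma unitary_rot2 t : unitary (rot2 t).
Proof. by split; rewrite adj_rot2 ?rot2NK // -{1}(opprK t) rot2NK. Qed.

(** A folded name for the imaginary unit, which can be generalised to a variable with square -1
    before calling [ring] or [field]. *)
Definition imc : C := 'i.

Lemma imc_sqr : imc ^+ 2 = -1.
Proof. exact: sqr_i. Qed.

Lemma pauliE : (pauli R 0 = mx2 0 1 1 0) * (pauli R 1 = mx2 0 (- imc) imc 0) *
  (pauli R 2 = mx2 1 0 0 (-1)).
Proof. by do !split; apply: matrix2P; rewrite mx2E mxE. Qed.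

(** The Pauli matrices are a basis of the traceless matrices, orthogonal for the trace pairing with
    squared norm 2, whence the factor one half. *)
Lemma pauli_expand (N : 'M[C]_2) : \tr N = 0 ->
  N = \sum_c (2^-1 * \tr (pauli R c *m N)) *: pauli R c.
Proof.
rewrite (mx2_eta N) mxtrace2 !mx2E => /eqP; rewrite addrC addr_eq0 => /eqP ->.
move: (N 0 0) (N 0 1) (N 1 0) => x y z.
rewrite sum3 !pauliE !mul_mx2 !mxtrace2 !mx2E !scale_mx2 !add_mx2.
have i2 := imc_sqr; have n2 : (2 : C) != 0 by rewrite pnatr_eq0.
move: imc i2 => I i2; congr mx2.
- by field.
- transitivity (2^-1 * (y * (1 - I ^+ 2) + z * (1 + I ^+ 2))); first by rewrite i2; field.
  by field.
- transitivity (2^-1 * (y * (1 + I ^+ 2) + z * (1 - I ^+ 2))); first by rewrite i2; field.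
  by field.
- by field.
Qed.

Lemma pauli_tr0 a : \tr (pauli R a) = 0.
Proof.
by move: a; apply: ord3P; rewrite mxtrace2 !pauliE !mx2E ?addr0 // subrr.
Qed.

(** Since [B sigma_b B^*] is traceless, it expands over the Pauli matrices, and its coefficients are
    column [b] of [rotO B]. *)
Lemma rotOM (A B : 'M[C]_2) : unitary B -> rotO (A *m B) = rotO A *m rotO B.
Proof.
move=> [_ uB]; apply/matrixP => a b; rewrite [LHS]mxE.
pose N := B *m pauli R b *m adjmx B.
have trN : \tr N = 0 by rewrite mxtrace_mulC mulmxA uB mul1mx pauli_tr0.
have -> : pauli R a *m (A *m B) *m pauli R b *m adjmx (A *m B) =
    pauli R a *m A *m N *m adjmx A by rewrite adjmxM /N !mulmxA.
rewrite {1}(pauli_expand trN) mulmx_sumr mulmx_suml raddf_sum /= mulr_sumr mxE.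
apply: eq_bigr => c _; rewrite -scalemxAr -scalemxAl linearZ /= !mxE /N !mulmxA.
by rewrite mulrCA [RHS]mulrC mulrA.
Qed.

Lemma half_eq (x y : C) : x = y + y -> 2^-1 * x = y.
Proof. by move=> ->; rewrite -mulr2n -[y *+ 2]mulr_natl mulKf // pnatr_eq0. Qed.

Lemma rotO_phase2 s t :
  rotO (phase2 s t) = map_mx (real_complex R) (givens 0 1 (t - s)).
Proof.
apply/matrixP; apply: ord3P; apply: ord3P.
all: rewrite [LHS]mxE adj_phase2 !pauliE !mul_mx2 mxtrace2 !mx2E [RHS]mxE [givens _ _ _ _ _]mxE /=.
all: apply: half_eq; rewrite ?(mulr0, mul0r, mulr1, mul1r, addr0, add0r) ?subrr //.
all: rewrite /cis ?cosN ?sinN ?cosB ?sinB.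
all: simpc.
(* The fifth remaining goal is the entry at the rotation axis, where the moduli of the two phases
   appear. *)
5: rewrite -!expr2 !cos2Dsin2.
all: by congr (_ +i* _); ring.
Qed.

(** The rotation is about the second axis, whose positive sense goes from the third axis to the
    first; hence the order [2 0]. *)
Lemma rotO_rot2 t : rotO (rot2 t) = map_mx (real_complex R) (givens 2 0 (t + t)).
Proof.
have h : (cos t)%:C ^+ 2 + (sin t)%:C ^+ 2 = 1 by rewrite -!rmorphXn -rmorphD cos2Dsin2.
apply/matrixP; apply: ord3P; apply: ord3P.
all: rewrite [LHS]mxE adj_rot2 !pauliE !mul_mx2 mxtrace2 !mx2E [RHS]mxE [givens _ _ _ _ _]mxE /=.
all: apply: half_eq; rewrite ?cosN ?sinN ?cosD ?sinD ?(rmorphD, rmorphB, rmorphN, rmorphM) ?rmorph0 ?rmorph1 /=.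
all: move: (cos t)%:C (sin t)%:C imc imc_sqr h => c s I i2 h.
5: transitivity (- I ^+ 2 * ((c ^+ 2 + s ^+ 2) + (c ^+ 2 + s ^+ 2)));
  [by ring | by rewrite i2 h opprK mul1r].
all: by ring.
Qed.

(** The first column of [V] is a unit vector, so two phases and a real rotation carry it to the
    first basis vector. What remains of [V] fixes that vector and is therefore a diagonal phase. *)
Lemma unitary_euler (V : 'M[C]_2) : unitary V ->
  exists s t x y, V = phase2 s t *m rot2 x *m phase2 0 y.
Proof.
move=> uV.
(* The angle is chosen so that [cis t * z] is real. The radius [r] may be negative. *)
have polar (z : C) : exists t (r : R), z = cis t * r%:C.
  have [t ht] := cos_sin_root (complex.Im z) (complex.Re z).
  exists (- t), (complex.Re (cis t * z)); rewrite -[LHS]mul1r -(cisNK t) -mulrA.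
  congr (_ * _); case: z ht => a b; rewrite /cis; simpc => /= ht.
  by congr (_ +i* _); rewrite -ht; ring.
have [s [r0 e0]] := polar (V 0 0); have [t [r1 e1]] := polar (V 1 0).
have normcis u (r : R) : conjc (cis u * r%:C) * (cis u * r%:C) = (r ^+ 2)%:C.
  have conjcM (a b : C) : conjc (a * b) = conjc a * conjc b by exact: (rmorphM conjc).
  by rewrite conjcM conj_cis mulrACA cisNK mul1r conjc_real -expr2 rmorphXn.
have : (adjmx V *m V) 0 0 = 1 by case: (uV) => _ ->; rewrite mxE.
rewrite mulmx2E !adjmxE e0 e1 !normcis -rmorphD => -[].
move=> /cos_sin_param[x [r0E r1E]].
pose X := rot2 (- x) *m phase2 (- s) (- t) *m V.
have uX : unitary X.
  by apply: unitaryM => //; apply: unitaryM; [exact: unitary_rot2 | exact: unitary_phase2].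
have VE : V = phase2 s t *m rot2 x *m X.
  rewrite /X !mulmxA -(mulmxA _ (rot2 x)) -{1}(opprK x) rot2NK mulmx1.
  by rewrite -{1}(opprK s) -{1}(opprK t) phase2NK mul1mx.
have cx := cos2Dsin2 x.
have cisK u (z : C) : cis (- u) * (cis u * z) = z by rewrite mulrA cisNK mul1r.
have X0 : X 0 0 = 1.
  rewrite /X mulmx2E !mul_mx2 !mx2E e0 e1 r0E r1E cosN sinN opprK.
  rewrite !(mulr0, addr0, add0r) -!mulrA !cisK -!rmorphM -rmorphD -!expr2 cx.
  by rewrite rmorph1.
have X1 : X 1 0 = 0.
  rewrite /X mulmx2E !mul_mx2 !mx2E e0 e1 r0E r1E cosN sinN.
  rewrite !(mulr0, addr0, add0r) -!mulrA !cisK -!rmorphM -rmorphD.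
  by rewrite mulrC mulrN addNr rmorph0.
clearbody X; have [X' _] := uX.
(* The first row of [X] has norm 1 and already contains the entry 1. *)
have X01 : X 0 1 = 0.
  have /matrixP/(_ 0 0) := X'; rewrite mulmx2E !adjmxE X0 conjc1 mulr1 mxE eqxx mulr1n.
  move=> /(canRL (addKr _)); rewrite addNr => /eqP; rewrite mulf_eq0 conjc_eq0 orbb.
  by move/eqP.
have /matrixP/(_ 1 1) := X'; rewrite mulmx2E !adjmxE X1 mxE /= mul0r add0r.
move=> /cis_param[y yE]; exists s, t, x, y.
by rewrite VE; congr (_ *m _); apply: matrix2P; rewrite !mx2E ?cis0.
Qed.

Lemma givens_product_rotO (V : 'M[C]_2) : unitary V -> givens_product (rotO V).
Proof.
move=> /unitary_euler[s [t [x [y ->]]]].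
exists [:: (0, 1, t - s); (2, 0, x + x); (0, 1, y - 0)]; split=> //.
rewrite !big_cons big_nil mulr1 !rotOM; try exact: unitary_phase2; try exact: unitary_rot2.
by rewrite !rotO_phase2 rotO_rot2 -mulmxA -[RHS]/(map_mx (real_complex R) _) !map_mxM.
Qed.

End QubitRotations.

(** * Equalising the diagonal of a 2x2 matrix by a unitary *)

Section Flatten.
Variable R : realType.
Local Notation C := R[i].
(* The equal-diagonal condition fixes [W] only up to a diagonal phase, and the
   other condition is a homogeneous linear equation in the cosine and sine of it. *)
Lemma unitary_flatten (B : 'M[C]_2) (k l : R) : exists W : 'M[C]_2,
  [/\ unitary W, (W *m B *m adjmx W) 0 0 = (W *m B *m adjmx W) 1 1 &
    k * complex.Im ((W *m B *m adjmx W) 0 1) =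
    l * complex.Im ((W *m B *m adjmx W) 1 0)].
Proof.
have [W1 uW1 W1d] : exists2 W : 'M[C]_2, unitary W &
    (W *m B *m adjmx W) 0 0 = (W *m B *m adjmx W) 1 1.
  pose d := B 0 0 - B 1 1.
  have [d0|d0] := eqVneq d 0.
    exists 1%:M; first exact: unitary1.
    by rewrite adjmx1 mulmx1 mul1mx; apply/eqP; rewrite -subr_eq0 -/d d0.
  pose b := B 0 1 * conjc d; pose c := B 1 0 * conjc d.
  (* The equation says that [exp(- i t) b + exp(i t) c] is real, so that [g] becomes a real multiple
     of [d]. *)
  have [t ht] := cos_sin_root (complex.Im b + complex.Im c) (complex.Re c - complex.Re b).
  pose g := cis (- t) * B 0 1 + cis t * B 1 0.
  have gE : g * conjc d = (complex.Re (g * conjc d))%:C.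
    rewrite /g mulrDl -!mulrA -/b -/c -conj_cis.
    case: b c ht => b1 b2 [c1 c2]; rewrite /cis; simpc => /= ht.
    by congr (_ +i* _); rewrite -ht; ring.
  have dE : d * conjc d = (complex.Re (d * conjc d))%:C.
    by case: (d) => d1 d2; simpc => /=; congr (_ +i* _); ring.
  (* Rotating by [- h] turns the difference of the diagonal entries into
     [cos (2 h) d + sin (2 h) g]. Times [conjc d] both terms are real, so a single real equation in
     [z = 2 h] suffices. *)
  have [z hz] := cos_sin_root (complex.Re (d * conjc d)) (complex.Re (g * conjc d)).
  pose h := z / 2; have zE : z = h + h by rewrite /h; field.
  exists (rot2 (- h) *m phase2 0 t).
    by apply: unitaryM; [exact: unitary_rot2 | exact: unitary_phase2].
  have cd0 : conjc d != 0 by rewrite conjc_eq0.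
  apply/eqP; rewrite -subr_eq0; apply/eqP; apply: (mulIf cd0); rewrite mul0r.
  rewrite adjmxM adj_phase2 adj_rot2 {1 2}(mx2_eta B) /rot2 /phase2 !mul_mx2 !mx2E.
  rewrite oppr0 !opprK !sinN !cosN cis0.
  have hz' : (cos z)%:C * (d * conjc d) + (sin z)%:C * (g * conjc d) = 0.
    by rewrite gE dE -!rmorphM -rmorphD ![_ * complex.Re _]mulrC hz rmorph0.
  have := cisNK t; move: hz'; move: (conjc d) => d'.
  rewrite zE cosD sinD /d /g.
  rewrite !(rmorphD, rmorphB, rmorphN, rmorphM) /=.
  move: (cos h)%:C (sin h)%:C (cis t) (cis (- t)) => u v e e' hz' ee.
  transitivity ((u * u - v * v) * B 1 1 * (1 - e' * e) * d' +
    ((u * u - v * v) * ((B 0 0 - B 1 1) * d') +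
     (v * u + u * v) * ((e' * B 0 1 + e * B 1 0) * d'))); first by ring.
  by rewrite hz' ee subrr mulr0 mul0r addr0.
(* Conjugation by [phase2 p 0] keeps the diagonal and multiplies the other entries by [cis p] and
   [cis (- p)]; the root [p] solves the required relation between their imaginary parts. *)
have [p hp] := cos_sin_root (k * complex.Im ((W1 *m B *m adjmx W1) 0 1) -
                             l * complex.Im ((W1 *m B *m adjmx W1) 1 0))
  (k * complex.Re ((W1 *m B *m adjmx W1) 0 1) + l * complex.Re ((W1 *m B *m adjmx W1) 1 0)).
have [W uW WE] : exists2 W : 'M[C]_2, unitary W & W *m B *m adjmx W =
    phase2 p 0 *m (W1 *m B *m adjmx W1) *m phase2 (- p) (- 0).
  exists (phase2 p 0 *m W1); first by apply: unitaryM => //; exact: unitary_phase2.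
  by rewrite adjmxM adj_phase2 !mulmxA.
exists W; rewrite WE.
move: W1d hp; rewrite (mx2_eta (W1 *m B *m adjmx W1)) /phase2 !mul_mx2 !mx2E.
rewrite oppr0 cis0 !(mul0r, mulr0, add0r, addr0, mul1r, mulr1).
move: (_ 0 0) (_ 0 1) (_ 1 0) (_ 1 1) => x [y1 y2] [z1 z2] x' -> hp; split.
- by [].
- by rewrite mulrAC -cisD subrr cis0 mul1r.
- rewrite /cis cosN sinN; simpc => /=; move: hp => /= hp.
  apply/eqP; rewrite -subr_eq0 -[X in _ == X]hp; apply/eqP; ring.
Qed.
End Flatten.

(** * Construction of [V] and [zeta] when [sin (2 a3) = 0] *)

Section ProductStates.
Variable R : realType.
Local Notation C := R[i].

Definition rotatable_to_product (U : 'M[C]_(2 * 2)) : Prop :=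
  forall rho : 'M[C]_(2 * 2), density rho ->
  exists V zeta : 'M[C]_2,
    [/\ unitary V, givens_product (rotO V), density zeta &
      ptrE (U *m ((V *t 1%:M) *m rho *m adjmx (V *t 1%:M)) *m adjmx U)
      = ptrE (U *m ((V *m ptrE rho *m adjmx V) *t zeta) *m adjmx U)].

Lemma density_diag (x y : C) : 0 <= x -> 0 <= y -> x + y = 1 -> density (mx2 x 0 0 y).
Proof.
move=> x0 y0 xy; have real (z : C) : 0 <= z -> conjc z = z.
  by case: z => a b; rewrite lecE => /= /andP[/eqP -> _]; rewrite oppr0.
split.
- by rewrite adj_mx2 !real // conjc0.
- move=> v; rewrite mulmx2E !mulmx2E !adjmxE !mx2E !(mulr0, addr0, add0r).
  by rewrite addr_ge0 // mulrAC mulr_ge0 // mulrC mulcJ_ge0.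
- by rewrite mxtrace2 !mx2E.
Qed.

Lemma sin_double_inS (a : R) : inS a -> sin (a + a) = 0.
Proof.
case=> n ->; rewrite (_ : _ + _ = 0 + pi *+ n).
  (* Adding [pi] changes the sign of the sine, so [sin (n pi)] is [sin 0] up to sign. *)
  by rewrite alternatingn ?sin0 ?mulr0 //; exact: sinDpi.
by rewrite add0r -mulr_natl; field.
Qed.

Lemma adj_ptrE (M : 'M[C]_(2 * 2)) : adjmx (ptrE M) = ptrE (adjmx M).
Proof.
rewrite !ptrE_envblk !envblk_adj; apply/matrixP => i j; rewrite !mxE.
exact: (rmorphD conjc).
Qed.

Lemma ptrE_conj_inj (A B M N : 'M[C]_(2 * 2)) :
  ptrE (A *m (M - N) *m B) = 0 -> ptrE (A *m M *m B) = ptrE (A *m N *m B).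
Proof. by rewrite mulmxBr mulmxBl ptrEB => /eqP; rewrite subr_eq0 => /eqP. Qed.

Lemma rotatable_Hgen3 (a1 a2 a3 : R) (Omega : 'M[C]_(2 * 2)) (L1 L2 R1 R2 : 'M[C]_2) :
  is_expmx (- 'i *: Hgen a1 a2 a3) Omega -> sin (a3 + a3) = 0 ->
  unitary L2 -> unitary R1 -> unitary R2 ->
  rotatable_to_product ((L1 *t L2) *m Omega *m (R1 *t R2)).
Proof.
move=> /expmx_Hgen OE s3 uL2 uR1 uR2 rho drho.
pose r1 := (1%:M *t R2) *m rho *m adjmx (1%:M *t R2).
have dr1 : density r1 by apply: density_conj => //; apply: unitary_tens => //; exact: unitary1.
have r1S : ptrE r1 = ptrE rho.
  by rewrite /r1 adjmx_tens adjmx1 ptrE_conj_env //; case: uR2.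
pose zd b := \tr (envblk r1 b b).
pose z1 := mx2 (zd 0) 0 0 (zd 1).
have zsum : zd 0 + zd 1 = 1.
  rewrite /zd -mxtraceD -ptrE_envblk; case: dr1 => _ _ <-.
  rewrite /mxtrace sum_mxtens; apply: eq_bigr => i _; rewrite mxE; apply: eq_bigr => k _.
  by [].
have zd_ge0 b : 0 <= zd b.
  by rewrite /zd mxtrace2; apply: addr_ge0; rewrite mxE; exact: density_diag_ge0.
have dz1 : density z1 by exact: density_diag.
pose D1 := r1 - ptrE rho *t z1.
(* These are the products [p * q] and [u * v] of [ptrE_paritymx_eq0] for the two parity blocks. *)
pose kk := cos (a1 - a2) * sin (a1 - a2); pose ll := cos (a1 + a2) * sin (a1 + a2).
have [W [uW Wd WI]] := unitary_flatten (envblk D1 0 1) kk ll.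
(* The factors [R1] and [R2] are undone in advance: after them the system sees [W] and the
   environment state is [z1]. *)
exists (adjmx R1 *m W), (adjmx R2 *m z1 *m R2).
have uV : unitary (adjmx R1 *m W) by apply: unitaryM => //; exact: unitary_adj.
split=> //.
- exact: givens_product_rotO.
- by rewrite -{2}(adjmxK R2); apply: density_conj => //; exact: unitary_adj.
pose D := (W *t 1%:M) *m D1 *m adjmx (W *t 1%:M).
set V := adjmx R1 *m W; set zeta := adjmx R2 *m z1 *m R2; pose U := (L1 *t L2) *m Omega *m (R1 *t R2); rewrite -/U.
have R1V : R1 *m V = W by rewrite /V mulmxA; case: uR1 => -> _; rewrite mul1mx.
have R2z : R2 *m zeta *m adjmx R2 = z1.
  rewrite /zeta !mulmxA; case: uR2 => R2R _; rewrite R2R mul1mx.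
  by rewrite -mulmxA R2R mulmx1.
pose DD := (V *t 1%:M) *m rho *m adjmx (V *t 1%:M) - (V *m ptrE rho *m adjmx V) *t zeta.
have DE : (R1 *t R2) *m DD *m adjmx (R1 *t R2) = D.
  rewrite /DD mulmxBr mulmxBl /D /D1 mulmxBr mulmxBl; congr (_ - _).
    rewrite /r1 !mulmxA tensmx_mul R1V mulmx1 tensmx_mul mulmx1 mul1mx.
    rewrite -!mulmxA -!adjmxM !mulmxA !tensmx_mul R1V mulmx1 mulmx1 mul1mx //.
  by rewrite !adjmx_tens !tensmx_mul adjmx1 mulmx1 mul1mx R2z -R1V adjmxM !mulmxA.
apply: ptrE_conj_inj; rewrite -/DD.
have -> : U *m DD *m adjmx U = (L1 *t L2) *m (Omega *m D *m adjmx Omega) *m adjmx (L1 *t L2).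
  by rewrite -DE /U !adjmxM !mulmxA.
rewrite ptrE_conj_unitary //.
suff -> : ptrE (Omega *m D *m adjmx Omega) = 0 by rewrite mulmx0 mul0mx.
have Dblk b d : envblk D b d = W *m envblk D1 b d *m adjmx W.
  by rewrite /D adjmx_tens adjmx1 envblk_conj_sys.
have ptrD1 : ptrE D1 = 0.
  by rewrite /D1 ptrEB r1S ptrE_tens; case: dz1 => _ _ ->; rewrite scale1r subrr.
(* Hermiticity makes the block [1 0] the adjoint of the block [0 1], so conditions on the latter
   control both. *)
have D1h : adjmx D1 = D1.
  case: dr1 => h1 _ _; case: dz1 => h2 _ _; case: drho => h3 _ _.
  rewrite /D1 adjmxB h1 adjmx_tens h2; congr (_ - _ *t _).
  by rewrite adj_ptrE h3.
have D10 : envblk D 1 0 = adjmx (envblk D 0 1).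
  by rewrite !Dblk -{1}D1h envblk_adj !adjmxM adjmxK mulmxA.
have tr00 : \tr (envblk D 0 0) = 0.
  rewrite Dblk mxtrace_mulC mulmxA; case: uW => _ ->; rewrite mul1mx.
  rewrite /D1 envblkB envblk_tens mx2E linearB /= linearZ /= -r1S ptrE_envblk mxtraceD.
  by rewrite -/(zd 0) -/(zd 1) zsum mulr1 subrr.
rewrite {}OE adj_paritymx.
have mi (x : R) : 0 -i* x = - imc R * x%:C by rewrite /imc; simpc.
have adjE x (c s : R) : adjmx (cis x *: mx2 c%:C (0 -i* s) (0 -i* s) c%:C) =
    cis (- x) *: mx2 c%:C (imc R * s%:C) (imc R * s%:C) c%:C.
  have conjcM (y z : C) : conjc (y * z) = conjc y * conjc z by exact: (rmorphM conjc).
  rewrite !scale_mx2 adj_mx2 !conjcM conj_cis conjc_real.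
  by congr mx2; congr (_ * _); rewrite /imc; simpc.
rewrite !adjE !mi opprK.
apply: ptrE_paritymx_eq0.
- exact: imc_sqr.
- exact: cisNK.
- by rewrite !expr2 -!cisD -opprD /cis cosN sinN s3 oppr0.
- by rewrite -!rmorphXn -rmorphD cos2Dsin2.
- by rewrite -!rmorphXn -rmorphD cos2Dsin2.
- by rewrite !Dblk -mulmxDl -mulmxDr -ptrE_envblk ptrD1 mulmx0 mul0mx.
- exact: tr00.
- by rewrite Dblk.
- by rewrite D10 !adjmxE Dblk Wd.
(* Each difference is a number minus its conjugate, hence [2 i] times an imaginary part, and the
   relation reduces to [WI]. *)
- rewrite D10 !adjmxE Dblk !subcJ.
  have : (kk * complex.Im ((W *m envblk D1 0 1 *m adjmx W) 0 1))%:C =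
    (ll * complex.Im ((W *m envblk D1 0 1 *m adjmx W) 1 0))%:C by rewrite WI.
  rewrite !rmorphM /= => h.
  have comb (a b c d e f : C) : a * c = b * d -> a * (e * c * f) = b * (e * d * f).
    by move=> abcd; transitivity (e * f * (a * c)); [ring | rewrite abcd; ring].
  by apply: comb.
Qed.

End ProductStates.

(** * Cyclic permutation of the three interaction axes *)

Section CyclicSymmetry.
Variable R : realType.
Local Notation C := R[i].

(* (1 - i (sigma_1 + sigma_2 + sigma_3)) / 2, the rotation by 2 pi / 3 about (1, 1, 1). *)
Definition cyclifford : 'M[C]_2 :=
  let h := 2^-1 : R in mx2 (h -i* h) (- h -i* h) (h -i* h) (h +i* h).

Lemma unitary_cyclifford : unitary cyclifford.
Proof.
rewrite /cyclifford; split; rewrite adj_mx2 mul_mx2 mx2_1; congr mx2; simpc.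
all: by congr (_ +i* _); field.
Qed.

Lemma cyclifford_pauli :
  (cyclifford *m pauli R 0 *m adjmx cyclifford = pauli R 1) *
  (cyclifford *m pauli R 1 *m adjmx cyclifford = pauli R 2) *
  (cyclifford *m pauli R 2 *m adjmx cyclifford = pauli R 0).
Proof.
rewrite !pauliE /cyclifford adj_mx2 !mul_mx2 /imc; do !split; congr mx2.
all: rewrite ?(mulr0, mul0r, addr0, add0r, mulr1); simpc.
all: by congr (_ +i* _); field.
Qed.

Lemma Hgen_cyclifford (a1 a2 a3 : R) :
  (cyclifford *t cyclifford) *m Hgen a1 a2 a3 *m adjmx (cyclifford *t cyclifford) =
  Hgen a3 a1 a2.
Proof.
have conjT (K K' P0 P1 P2 : 'M[C]_2) c0 c1 c2 :
    K *m P0 *m K' = P1 -> K *m P1 *m K' = P2 -> K *m P2 *m K' = P0 ->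
    (K *t K) *m (c0 *: (P0 *t P0) + c1 *: (P1 *t P1) + c2 *: (P2 *t P2)) *m (K' *t K')
    = c2 *: (P0 *t P0) + c0 *: (P1 *t P1) + c1 *: (P2 *t P2).
  move=> h0 h1 h2; rewrite !mulmxDr !mulmxDl -!scalemxAr -!scalemxAl !tensmx_mul.
  by rewrite h0 h1 h2 addrC addrA.
by rewrite adjmx_tens; apply: conjT; rewrite cyclifford_pauli.
Qed.

(** The local factors are quantified inside so that a change of axes can be absorbed into them. *)
Definition rotatable_interaction (a1 a2 a3 : R) : Prop :=
  forall (Omega : 'M[C]_(2 * 2)) (L1 L2 R1 R2 : 'M[C]_2),
  is_expmx (- 'i *: Hgen a1 a2 a3) Omega ->
  unitary L2 -> unitary R1 -> unitary R2 ->
  rotatable_to_product ((L1 *t L2) *m Omega *m (R1 *t R2)).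

Lemma rotatable_cyclic (a1 a2 a3 : R) :
  rotatable_interaction a3 a1 a2 -> rotatable_interaction a1 a2 a3.
Proof.
move=> h Omega L1 L2 R1 R2 hO uL2 uR1 uR2.
have uK := unitary_cyclifford; have [KK KK'] := unitary_tens uK uK.
pose K := cyclifford; pose Omega' := (K *t K) *m Omega *m adjmx (K *t K).
have hO' : is_expmx (- 'i *: Hgen a3 a1 a2) Omega'.
  by rewrite -Hgen_cyclifford scalemxAl scalemxAr; exact: is_expmx_conj.
have -> : (L1 *t L2) *m Omega *m (R1 *t R2) =
    ((L1 *m adjmx K) *t (L2 *m adjmx K)) *m Omega' *m ((K *m R1) *t (K *m R2)).
  have insert (A B X P Q : 'M[C]_(2 * 2)) : Q *m P = 1%:M ->
      A *m X *m B = (A *m Q) *m (P *m X *m Q) *m (P *m B).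
    by move=> QP; rewrite !mulmxA -(mulmxA A Q P) QP mulmx1 -(mulmxA (A *m X) Q P) QP mulmx1.
  by rewrite -!tensmx_mul -adjmx_tens; exact: insert.
by apply: h => //; apply: unitaryM => //; exact: unitary_adj.
Qed.

End CyclicSymmetry.

Theorem theorem1 (R : realType) (a1 a2 a3 : R) (Omega : 'M[R[i]]_(2 * 2))
  (L1 L2 R1 R2 : 'M[R[i]]_2) :
  is_expmx (- 'i *: Hgen a1 a2 a3) Omega ->
  exactly_one_inS a1 a2 a3 ->
  unitary L1 -> unitary L2 -> unitary R1 -> unitary R2 ->
  forall rhoSE : 'M[R[i]]_(2 * 2), density rhoSE ->
  let U := (L1 *t L2) *m Omega *m (R1 *t R2) in
  let rhoS := ptrE rhoSE in
  exists (V : 'M[R[i]]_2) (zeta : 'M[R[i]]_2),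
    [/\ unitary V, givens_product (rotO V), density zeta &
      ptrE (U *m ((V *t 1%:M) *m rhoSE *m adjmx (V *t 1%:M)) *m adjmx U)
      = ptrE (U *m ((V *m rhoS *m adjmx V) *t zeta) *m adjmx U)].
Proof.
move=> hO one _ uL2 uR1 uR2.
have third b1 b2 b3 : inS b3 -> @rotatable_interaction R b1 b2 b3.
  move=> /sin_double_inS s3 ? ? ? ? ? hE uL uR uR'.
  exact: (rotatable_Hgen3 _ hE s3 uL uR uR').
suff : rotatable_interaction a1 a2 a3 by apply.
case: one => [[h1 _]|[_ [h2 _]]|[_ [_ h3]]].
(* Each shift moves the last coefficient to the front: two shifts leave [a1] in third place, one
   shift leaves [a2] there. *)
- by do 2!apply: rotatable_cyclic; exact: third.
- by apply: rotatable_cyclic; exact: third.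
- exact: third.
Qed.
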